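(* Let $d=2$, and let $\Gamma=\{\gamma(\tau):0\le\tau\le\mathcal T\}$ be a limit cycle of $\dot x=b(x)$ in $\mathbb{R}^2$, where $\gamma$ has least period $\mathcal T>0$. Let $\vec n(\tau)$ be the unit normal vector of $\Gamma$ at $\gamma(\tau)$, and set $$\widetilde A(\tau)=\langle\vec n(\tau),a(\gamma(\tau))\vec n(\tau)\rangle\ge0,\qquad \widetilde M(\tau)=\langle\vec n(\tau),\partial_xb(\gamma(\tau))\,\vec n(\tau)\rangle .$$ Consider the scalar periodic Riccati equation $$\dot G(\tau)=-2\widetilde M(\tau)G(\tau)-\widetilde A(\tau)G(\tau)^2$$ and the associated Lyapunov equation $\dot H(\tau)=2\widetilde M(\tau)H(\tau)+\widetilde A(\tau)$ for $H=1/G$. The solution of the Lyapunov equation is $$H(\tau)=H(0)\exp\Bigl(2\int_0^\tau\widetilde M(s)\,ds\Bigr)+\int_0^\tau\widetilde A(s)\exp\Bigl(2\int_s^\tau\widetilde M(r)\,dr\Bigr)ds ,$$ and the $\mathcal T$-periodic solution, for which $H(0)=H(\mathcal T)$, has $$H(0)=\frac{\displaystyle\int_0^{\mathcal T}\widetilde A(s)\exp\Bigl(2\int_s^{\mathcal T}\widetilde M(r)\,dr\Bigr)ds}{\displaystyle1-\exp\Bigl(2\int_0^{\mathcal T}\widetilde M(s)\,ds\Bigr)} .$$ The periodic solution of the Riccati equation is $G(\tau)=1/H(\tau)$ with this $H$. Moreover, the two conditions (i) $\exp\bigl(\int_0^{\mathcal T}\widetilde M(s)\,ds\bigr)<1$,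 i.e. $\int_0^{\mathcal T}\widetilde M(s)\,ds<0$ (which is asymptotic stability of $\Gamma$), and (ii) $\widetilde A(\tau)\not\equiv0$, are exactly the sufficient and necessary conditions for $H(0)>0$, in which case the Riccati equation has a unique positive ($\mathcal T$-periodic) solution $G(\cdot)$.
   Context: $b:\mathbb{R}^2\to\mathbb{R}^2$ is a smooth vector field with Jacobian matrix $\partial_xb$; $\sigma$ is a $2\times2$ matrix-valued function on $\mathbb{R}^2$ and $a(x)=\sigma(x)\sigma(x)^{\mathsf T}$. $\gamma$ is a periodic solution of $\dot\gamma(\tau)=b(\gamma(\tau))$ with least period $\mathcal T>0$, and $\dot\gamma$ never vanishes. The unit normal $\vec n(\tau)$ is obtained by rotating the unit tangent $\dot\gamma(\tau)/|\dot\gamma(\tau)|$ by the angle $\pi/2$. Asymptotic stability of $\Gamma$ means that, except for the trivial characteristic multiplier $1$, the other characteristic multiplier of $\dot y=\partial_xb(\gamma(\tau))y$ (eigenvalue of its period-$\mathcal T$ fundamental matrix) lies in the open unit disk; here that multiplier is $\exp\bigl(\int_0^{\mathcal T}\widetilde M(s)\,ds\bigr)$.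
   Formalization: The matrix field σ is assumed continuous; without regularity the claim fails: if σ is nonzero only at one point of a stable Γ, then Ã≢0 but H(0)=0. *)

(* Defs.v *)
From Stdlib Require Import Reals.
From Coquelicot Require Import Coquelicot.
Open Scope R_scope.

(* The plane is [R * R]; 2x2 matrices are Coquelicot's [matrix 2 2], with
   entries [coeff_mat 0 A i j] numbered from 0. *)

Definition inner (u v : R * R) : R := fst u * fst v + snd u * snd v.

Definition norm2 (u : R * R) : R := sqrt (inner u u).

Definition rot90 (u : R * R) : R * R := (- snd u, fst u).

Definition apply_mat (A : @matrix R 2 2) (v : R * R) : R * R :=
  (coeff_mat 0 A 0 0 * fst v + coeff_mat 0 A 0 1 * snd v,
   coeff_mat 0 A 1 0 * fst v + coeff_mat 0 A 1 1 * snd v).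

Definition transpose (A : @matrix R 2 2) : @matrix R 2 2 :=
  mk_matrix 2 2 (fun i j => coeff_mat 0 A j i).

(* [ex_diff_n f n x y] says that all iterated partial derivatives of [f] of
   order at most [n] exist and are continuous at [(x, y)]; over all points and
   all [n] this is C^infinity. *)
Definition smooth_field (b : R * R -> R * R) : Prop :=
  forall (n : nat) (x y : R),
    ex_diff_n (fun u v => fst (b (u, v))) n x y /\
    ex_diff_n (fun u v => snd (b (u, v))) n x y.

Definition jacobian (b : R * R -> R * R) (x : R * R) : @matrix R 2 2 :=
  mk_matrix 2 2 (fun i j =>
    let bi := fun u v => match i with
                         | O => fst (b (u, v))
                         | _ => snd (b (u, v))
                         end in
    match j with
    | O => Derive (fun u => bi u (snd x)) (fst x)
    | _ => Derive (fun v => bi (fst x) v) (snd x)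
    end).

Definition continuous_matrix_field (sigma : R * R -> @matrix R 2 2) : Prop :=
  forall (i j : nat) (x : R * R), (i < 2)%nat -> (j < 2)%nat ->
    continuous (fun y : R * R => coeff_mat 0 (sigma y) i j) x.

Definition diffusion (sigma : R * R -> @matrix R 2 2) (x : R * R)
  : @matrix R 2 2 :=
  @Mmult R_Ring 2 2 2 (sigma x) (transpose (sigma x)).

Definition periodic {E : Type} (T : R) (f : R -> E) : Prop :=
  forall tau : R, f (tau + T) = f tau.

Definition velocity (gamma : R -> R * R) (tau : R) : R * R :=
  (Derive (fun s => fst (gamma s)) tau, Derive (fun s => snd (gamma s)) tau).

(* A limit cycle is taken here to be any non-constant closed orbit with least
   period [T]; it need not be isolated among the closed orbits of [b]. *)
Definition limit_cycle (b : R * R -> R * R) (gamma : R -> R * R) (T : R)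
  : Prop :=
  (forall tau : R, is_derive gamma tau (b (gamma tau))) /\
  0 < T /\
  periodic T gamma /\
  (forall p : R, 0 < p -> periodic p gamma -> T <= p) /\
  (forall tau : R, velocity gamma tau <> (0, 0)).

Definition unit_tangent (gamma : R -> R * R) (tau : R) : R * R :=
  let v := velocity gamma tau in (fst v / norm2 v, snd v / norm2 v).

Definition unit_normal (gamma : R -> R * R) (tau : R) : R * R :=
  rot90 (unit_tangent gamma tau).

Definition A_tilde (sigma : R * R -> @matrix R 2 2) (gamma : R -> R * R)
  (tau : R) : R :=
  let n := unit_normal gamma tau in
  inner n (apply_mat (diffusion sigma (gamma tau)) n).

Definition M_tilde (b : R * R -> R * R) (gamma : R -> R * R) (tau : R) : R :=
  let n := unit_normal gamma tau in
  inner n (apply_mat (jacobian b (gamma tau)) n).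

Definition fundamental_matrix (b : R * R -> R * R) (gamma : R -> R * R)
  (Phi : R -> @matrix R 2 2) : Prop :=
  Phi 0 = @Mone R_Ring 2 /\
  forall (i j : nat) (tau : R), (i < 2)%nat -> (j < 2)%nat ->
    is_derive (fun s => coeff_mat 0 (Phi s) i j) tau
      (coeff_mat 0 (@Mmult R_Ring 2 2 2 (jacobian b (gamma tau)) (Phi tau)) i j).

(* [mu1] and [mu2] are the eigenvalues of [A] in [C], with multiplicity: the
   characteristic polynomial det (z - A) is (z - mu1) (z - mu2). *)
Definition eigenvalues (A : @matrix R 2 2) (mu1 mu2 : C) : Prop :=
  forall z : C,
    ((z - RtoC (coeff_mat 0%R A 0 0)) * (z - RtoC (coeff_mat 0%R A 1 1))
      - RtoC (coeff_mat 0%R A 0 1) * RtoC (coeff_mat 0%R A 1 0)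
     = (z - mu1) * (z - mu2))%C.

(* The trivial multiplier 1 is discounted only once, so a double multiplier 1
   is not asymptotically stable. *)
Definition asymptotically_stable (b : R * R -> R * R) (gamma : R -> R * R)
  (T : R) : Prop :=
  exists (Phi : R -> @matrix R 2 2) (mu : C),
    fundamental_matrix b gamma Phi /\
    eigenvalues (Phi T) (RtoC 1) mu /\
    Cmod mu < 1.

Definition riccati (A M : R -> R) (G : R -> R) : Prop :=
  forall tau : R, is_derive G tau (- 2 * M tau * G tau - A tau * G tau ^ 2).

Definition lyapunov (A M : R -> R) (H : R -> R) : Prop :=
  forall tau : R, is_derive H tau (2 * M tau * H tau + A tau).

Definition lyapunov_solution (A M : R -> R) (h0 tau : R) : R :=
  h0 * exp (2 * RInt M 0 tau)
  + RInt (fun s => A s * exp (2 * RInt M s tau)) 0 tau.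

(* Meaningful only if [exp (2 * RInt M 0 T) <> 1]. *)
Definition periodic_H0 (A M : R -> R) (T : R) : R :=
  RInt (fun s => A s * exp (2 * RInt M s T)) 0 T
  / (1 - exp (2 * RInt M 0 T)).

Definition periodic_H (A M : R -> R) (T tau : R) : R :=
  lyapunov_solution A M (periodic_H0 A M T) tau.

(* Main.v *)
Require Import Defs.
From Stdlib Require Import Reals Lra Lia.
From Coquelicot Require Import Coquelicot.
Open Scope R_scope.

(* The substitution [H = 1 / G] linearises the Riccati equation, and a Riccati
   solution that vanishes once vanishes identically, so the scalar claims reduce
   to variation of constants for the Lyapunov equation and to the closing
   condition [H 0 = H T].

   For the stability claim, differentiating [velocity gamma = b (gamma)] shows
   that the velocity solves the variational equation, which gives the
   multiplier 1.  Reduction of order in the moving frame of the cycle yields a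
   second solution whose normal component is [exp (int M)], so that the
   monodromy matrix of this explicit fundamental matrix has trace
   [1 + exp (int_0^T M)] and determinant [exp (int_0^T M)].  By Liouville's
   formula every fundamental matrix has the same determinant at [T], which
   determines the other multiplier. *)

(** * The scalar periodic equations *)

Lemma derive_zero_constant (f : R -> R) :
  (forall t, is_derive f t 0) -> forall s t, f s = f t.
Proof.
intros Hf s t.
destruct (MVT_gen f s t (fun _ => 0)) as [c [_ Hc]].
- intros x _; apply Hf.
- intros x _; apply continuity_pt_filterlim.
  apply (@ex_derive_continuous R_AbsRing R_NormedModule); eexists; apply Hf.
- lra.
Qed.

Lemma ex_RInt_continuous_all (f : R -> R) (a c : R) :
  (forall t, continuous f t) -> ex_RInt f a c.
Proof.
intros Hf; apply (@ex_RInt_continuous R_CompleteNormedModule).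
intros z _; apply Hf.
Qed.

Lemma is_derive_primitive (f : R -> R) (a t : R) :
  (forall s, continuous f s) -> is_derive (fun x => RInt f a x) t (f t).
Proof.
intros Hf; apply (@is_derive_RInt R_NormedModule f _ a).
- apply filter_forall; intro y.
  apply (@RInt_correct R_CompleteNormedModule).
  now apply ex_RInt_continuous_all.
- apply Hf.
Qed.

Lemma RInt_Chasles_all (f : R -> R) (a c d : R) :
  (forall t, continuous f t) -> RInt f a c + RInt f c d = RInt f a d.
Proof.
intros Hf; apply (@RInt_Chasles R_CompleteNormedModule);
  now apply ex_RInt_continuous_all.
Qed.

Lemma RInt_zero_width (f : R -> R) (a : R) : RInt f a a = 0.
Proof. exact (@RInt_point R_CompleteNormedModule a f). Qed.

Lemma continuous_of_derive (f df : R -> R) :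
  (forall t, is_derive f t (df t)) -> forall t, continuous f t.
Proof.
intros Hf t; apply (@ex_derive_continuous R_AbsRing R_NormedModule).
exists (df t); apply Hf.
Qed.

Lemma continuous_Rmult (f g : R -> R) (t : R) :
  continuous f t -> continuous g t -> continuous (fun x => f x * g x) t.
Proof. exact (@continuous_mult R_UniformSpace R_AbsRing f g t). Qed.

Lemma continuous_Rplus (f g : R -> R) (t : R) :
  continuous f t -> continuous g t -> continuous (fun x => f x + g x) t.
Proof. exact (@continuous_plus R_UniformSpace R_AbsRing R_NormedModule f g t). Qed.

Lemma continuous_Ropp (f : R -> R) (t : R) :
  continuous f t -> continuous (fun x => - f x) t.
Proof. exact (@continuous_opp R_UniformSpace R_AbsRing R_NormedModule f t). Qed.

Ltac continuity_R :=
  lazymatch goal with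
  | |- continuous (fun x => _ + _) _ => apply continuous_Rplus; continuity_R
  | |- continuous (fun x => _ * _) _ => apply continuous_Rmult; continuity_R
  | |- continuous (fun x => - _) _ => apply continuous_Ropp; continuity_R
  | |- continuous (fun _ => ?c) _ => apply continuous_const
  | |- continuous (fun x => ?f x) _ =>
      match goal with H : forall t, continuous f t |- _ => apply H end
  | |- continuous ?f _ =>
      match goal with H : forall t, continuous f t |- _ => apply H end
  end.

(** Meant for the side goals of [auto_derive]: each remaining [Derive] is replaced by the value
    known from a hypothesis. *)
Ltac derive_values :=
  repeat match goal with
  | H : is_derive _ ?x ?l |- context [Derive ?g ?x] =>
      replace (Derive g x) with l by (symmetry; apply is_derive_unique; exact H)
  end.

(** Integrating factor: [y * exp (- K)] has zero derivative. This yields uniqueness for the Lyapunov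
    equation, non-vanishing for the Riccati equation, and Liouville's formula. *)
Lemma linear_ode_solution (k y : R -> R) :
  (forall t, continuous k t) ->
  (forall t, is_derive y t (k t * y t)) ->
  forall s t, y t = y s * exp (RInt k s t).
Proof.
intros Hk Hy s t.
assert (E : y t * exp (- RInt k s t) = y s * exp (- RInt k s s)).
{ set (K := fun x => RInt k s x).
  apply (derive_zero_constant (fun x => y x * exp (- K x))).
  intro x.
  pose proof (Hy x) as Hyx.
  assert (Hkx : is_derive K x (k x)) by now apply is_derive_primitive.
  auto_derive.
  - repeat split; eexists; eassumption.
  - derive_values; ring. }
rewrite RInt_zero_width, Ropp_0, exp_0, Rmult_1_r, exp_Ropp in E.
rewrite <- E; field; apply Rgt_not_eq, exp_pos.
Qed.

Lemma periodic_nonneg_shift (E : Type) (T : R) (f : R -> E) :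
  0 < T -> periodic T f -> forall t, exists s, 0 <= s /\ f s = f t.
Proof.
intros HT Hf t.
assert (Hn : forall n : nat, f (t + INR n * T) = f t).
{ intro n; induction n as [|n IH].
  - simpl; f_equal; ring.
  - rewrite S_INR, <- IH, <- (Hf (t + INR n * T)); f_equal; ring. }
destruct (nfloor_ex (Rabs (t / T))) as [n [_ Hlt]]; [apply Rabs_pos|].
(* One period more than the floor of |t/T| exceeds -t/T whatever the sign of [t]. *)
exists (t + INR (S n) * T); split; [|apply Hn].
rewrite S_INR.
assert (Ht : - (t / T) <= Rabs (t / T))
  by (rewrite <- Rabs_Ropp; apply Rle_abs).
assert (- t <= (INR n + 1) * T); [|lra].
replace (- t) with (- (t / T) * T) by (field; lra).
apply Rmult_le_compat_r; lra.
Qed.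

Lemma periodic_reduce (E : Type) (T : R) (f : R -> E) :
  0 < T -> periodic T f -> forall t, exists s, 0 <= s <= T /\ f s = f t.
Proof.
intros HT Hf t.
destruct (periodic_nonneg_shift E T f HT Hf t) as [s [Hs E1]].
destruct (nfloor_ex (s / T)) as [n [Hn1 Hn2]];
  [apply Rmult_le_pos; [|left; apply Rinv_0_lt_compat]; lra|].
(* Periodicity shifts forward, so the induction climbs from the reduced point back up to [s]. *)
assert (Hn : f (s - INR n * T + INR n * T) = f (s - INR n * T)).
{ generalize (s - INR n * T); clear - Hf; intro u.
  induction n as [|n IH].
  - simpl; f_equal; ring.
  - rewrite S_INR, <- IH, <- (Hf (u + INR n * T)); f_equal; ring. }
exists (s - INR n * T).
assert (Es : s = s / T * T) by (field; lra).
assert (INR n * T <= s) by (rewrite Es; apply Rmult_le_compat_r; lra).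
assert (s <= (INR n + 1) * T) by (rewrite Es at 1; apply Rmult_le_compat_r; lra).
split; [split; lra|].
rewrite <- Hn, <- E1; f_equal; ring.
Qed.

Lemma exp_lt_1 (x : R) : exp x < 1 <-> x < 0.
Proof.
rewrite <- exp_0; split; [apply exp_lt_inv | apply exp_increasing].
Qed.

(* Since [RInt M s t = RInt M 0 t - RInt M 0 s], the [t]-dependence of the
   integrand factors out, and the solution can be differentiated. *)
Lemma lyapunov_solution_factored (A M : R -> R) (h t : R) :
  (forall s, continuous A s) -> (forall s, continuous M s) ->
  lyapunov_solution A M h t =
  exp (2 * RInt M 0 t) *
    (h + RInt (fun s => A s * exp (- 2 * RInt M 0 s)) 0 t).
Proof.
intros HA HM; unfold lyapunov_solution.
rewrite Rmult_plus_distr_l, Rmult_comm; f_equal.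
assert (HE : forall s, continuous (fun s => exp (- 2 * RInt M 0 s)) s).
{ intro s; apply continuous_exp_comp.
  apply continuous_Rmult; [apply continuous_const|].
  apply (continuous_of_derive _ M); intro; now apply is_derive_primitive. }
transitivity (RInt (fun s => scal (exp (2 * RInt M 0 t))
                             (A s * exp (- 2 * RInt M 0 s))) 0 t).
- apply RInt_ext; intros s _.
  rewrite <- (RInt_Chasles_all M 0 s t HM).
  change scal with Rmult; simpl.
  rewrite <- (Rmult_comm (A s * _)), Rmult_assoc, <- exp_plus.
  f_equal; f_equal; ring.
- apply (@RInt_scal R_CompleteNormedModule).
  apply ex_RInt_continuous_all; intro s; now apply continuous_Rmult.
Qed.

Lemma lyapunov_solution_0 (A M : R -> R) (h : R) :
  lyapunov_solution A M h 0 = h.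
Proof.
unfold lyapunov_solution.
rewrite !RInt_zero_width, Rmult_0_r, exp_0; ring.
Qed.

Lemma lyapunov_solution_correct (A M : R -> R) (h : R) :
  (forall s, continuous A s) -> (forall s, continuous M s) ->
  lyapunov A M (lyapunov_solution A M h).
Proof.
intros HA HM t.
set (F := fun s => A s * exp (- 2 * RInt M 0 s)).
assert (HF : forall s, continuous F s).
{ intro s; apply continuous_Rmult; [apply HA|].
  apply continuous_exp_comp.
  apply continuous_Rmult; [apply continuous_const|].
  apply (continuous_of_derive _ M); intro; now apply is_derive_primitive. }
set (m := fun t => RInt M 0 t); set (N := fun t => RInt F 0 t).
apply is_derive_ext with (fun t => exp (2 * m t) * (h + N t)).
{ intro s; symmetry; now apply lyapunov_solution_factored. }
rewrite lyapunov_solution_factored by assumption; fold F (m t) (N t).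
assert (DM : is_derive m t (M t)) by now apply is_derive_primitive.
assert (DF : is_derive N t (F t)) by now apply is_derive_primitive.
auto_derive.
- repeat split; eexists; eassumption.
- derive_values.
  (* The prefactor [exp (2 * m t)] cancels the exponential in [F t], leaving the source term
     [A t]. *)
  unfold F; fold (m t); replace (- 2 * m t) with (- (2 * m t)) by ring.
  rewrite exp_Ropp; field; apply Rgt_not_eq, exp_pos.
Qed.

(** * Uniqueness and periodicity for the Lyapunov equation *)

(** The source term cancels in the difference [H - K], which solves a homogeneous linear equation
    and so vanishes everywhere once it vanishes at [s]. *)
Lemma lyapunov_unique (A M H K : R -> R) :
  (forall s, continuous M s) -> lyapunov A M H -> lyapunov A M K ->
  forall s, H s = K s -> forall t, H t = K t.
Proof.
intros HM HH HK s E t.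
assert (D : forall x, is_derive (fun x => H x - K x) x (2 * M x * (H x - K x))).
{ intro x.
  replace (2 * M x * (H x - K x))
    with (minus (2 * M x * H x + A x) (2 * M x * K x + A x))
    by (unfold minus, plus, opp; simpl; ring).
  now apply (@is_derive_minus R_AbsRing R_NormedModule). }
pose proof (linear_ode_solution (fun x => 2 * M x) _
  (fun x => continuous_Rmult _ _ x (continuous_const _ _) (HM x)) D s t) as L.
simpl in L; rewrite E, Rminus_diag, Rmult_0_l in L; lra.
Qed.

Lemma lyapunov_iff_solution (A M H : R -> R) :
  (forall s, continuous A s) -> (forall s, continuous M s) ->
  lyapunov A M H <-> (forall t, H t = lyapunov_solution A M (H 0) t).
Proof.
intros HA HM; split.
- intro HH.
  apply (lyapunov_unique A M) with 0; trivial.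
  + now apply lyapunov_solution_correct.
  + now rewrite lyapunov_solution_0.
- intros E t.
  apply is_derive_ext with (lyapunov_solution A M (H 0)); [now symmetry|].
  rewrite (E t); now apply lyapunov_solution_correct.
Qed.

Lemma lyapunov_shift (A M H : R -> R) (T : R) :
  periodic T A -> periodic T M -> lyapunov A M H ->
  lyapunov A M (fun t => H (t + T)).
Proof.
intros PA PM HH t.
replace (2 * M t * H (t + T) + A t)
  with (1 * (2 * M (t + T) * H (t + T) + A (t + T)))
  by (rewrite PA, PM; ring).
apply (@is_derive_comp R_AbsRing R_NormedModule H (fun t => t + T)).
- apply HH.
- auto_derive; [exact I | ring].
Qed.

(** The shift of [H] by [T] solves the same equation, so agreement with [H] at time 0 is agreement
    at all times. *)
Lemma lyapunov_periodic_iff (A M H : R -> R) (T : R) :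
  (forall s, continuous M s) -> periodic T A -> periodic T M ->
  lyapunov A M H -> (periodic T H <-> H 0 = H T).
Proof.
intros HM PA PM HH; split; intro E.
- now rewrite <- (E 0), Rplus_0_l.
- intro t.
  apply (lyapunov_unique A M (fun t => H (t + T)) H HM) with 0; trivial.
  + now apply lyapunov_shift.
  + now rewrite Rplus_0_l.
Qed.

(** The closing condition is the affine equation h = q h + N with q different from 1. *)
Lemma lyapunov_solution_closed_iff (A M : R -> R) (T h : R) :
  exp (2 * RInt M 0 T) <> 1 ->
  (h = lyapunov_solution A M h T <-> h = periodic_H0 A M T).
Proof.
intro q1; unfold lyapunov_solution, periodic_H0.
set (q := exp _) in *; set (N := RInt (fun s => _) 0 T).
assert (1 - q <> 0) by lra.
split; intro E.
- apply Rmult_eq_reg_r with (1 - q); [|assumption].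
  unfold Rdiv; rewrite Rmult_assoc, Rinv_l, Rmult_1_r by assumption; lra.
- rewrite E; field; assumption.
Qed.

(** * The Riccati equation through inversion *)

(** From (1/G)' = -G'/G^2, the Riccati right-hand side turns into 2 M / G + A; the converse inverts
    once more. *)
Lemma riccati_iff_lyapunov_inv (A M G : R -> R) :
  (forall t, G t <> 0) -> (riccati A M G <-> lyapunov A M (fun t => / G t)).
Proof.
intro NZ; split; intros HG t; pose proof (HG t) as HGt.
- apply (is_derive_inv G t _) in HGt; [|apply NZ].
  evar_last; [exact HGt|]; simpl; field; apply NZ.
- apply (is_derive_inv _ t) in HGt; [|apply Rinv_neq_0_compat, NZ].
  apply is_derive_ext with (fun y => / / G y); [intro; apply Rinv_inv|].
  evar_last; [exact HGt|]; simpl; field; apply NZ.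
Qed.

(* A solution of the Riccati equation solves [G' = k G] with the continuous
   coefficient [k = -2 M - A G]. *)
Lemma riccati_nonzero (A M G : R -> R) :
  (forall s, continuous A s) -> (forall s, continuous M s) ->
  riccati A M G -> (exists t, G t <> 0) -> forall t, G t <> 0.
Proof.
intros HA HM HG [s Hs] t.
assert (HGc := continuous_of_derive _ _ HG).
rewrite (linear_ode_solution (fun x => - 2 * M x + - (A x * G x)) G)
  with (s := s).
- apply Rmult_integral_contrapositive_currified; [assumption|].
  apply Rgt_not_eq, exp_pos.
- intro x; continuity_R.
- intro x; evar_last; [apply HG|]; simpl; ring.
Qed.

Lemma periodic_H_lyapunov (A M : R -> R) (T : R) :
  (forall s, continuous A s) -> (forall s, continuous M s) ->
  lyapunov A M (periodic_H A M T).
Proof. intros HA HM; now apply lyapunov_solution_correct. Qed.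

Lemma periodic_H_periodic (A M : R -> R) (T : R) :
  (forall s, continuous A s) -> (forall s, continuous M s) ->
  periodic T A -> periodic T M -> exp (2 * RInt M 0 T) <> 1 ->
  periodic T (periodic_H A M T).
Proof.
intros HA HM PA PM q1.
apply (lyapunov_periodic_iff A M); trivial.
- now apply periodic_H_lyapunov.
- unfold periodic_H; rewrite lyapunov_solution_0.
  now apply lyapunov_solution_closed_iff.
Qed.

(** The condition at one time excludes the zero solution and spreads to all times by
    [riccati_nonzero]. Inversion is a total function, so the right-hand side states explicitly that
    [periodic_H] does not vanish. *)
Lemma periodic_riccati_iff (A M : R -> R) (T : R) :
  (forall s, continuous A s) -> (forall s, continuous M s) ->
  periodic T A -> periodic T M -> exp (2 * RInt M 0 T) <> 1 ->
  forall G : R -> R,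
     (riccati A M G /\ periodic T G /\ (exists t, G t <> 0)) <->
     (forall t, periodic_H A M T t <> 0 /\ G t = / periodic_H A M T t).
Proof.
intros HA HM PA PM q1 G; split.
- intros [HG [PG NZ]].
  assert (NZ' := riccati_nonzero A M G HA HM HG NZ).
  assert (L := proj1 (riccati_iff_lyapunov_inv A M G NZ') HG).
  assert (P : periodic T (fun t => / G t)) by (intro t; now rewrite PG).
  (* Periodicity of [/ G] gives the closing condition, which fixes its initial value; uniqueness
     then fixes the whole function. *)
  assert (E0 : / G 0 = periodic_H0 A M T).
  { apply lyapunov_solution_closed_iff; trivial.
    rewrite <- (proj1 (lyapunov_iff_solution A M _ HA HM) L).
    now apply (lyapunov_periodic_iff A M (fun t => / G t)). }
  assert (E : forall t, / G t = periodic_H A M T t).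
  { apply (lyapunov_unique A M (fun t => / G t)) with 0; trivial.
    - now apply periodic_H_lyapunov.
    - unfold periodic_H; now rewrite lyapunov_solution_0. }
  intro t; rewrite <- E; split.
  + now apply Rinv_neq_0_compat.
  + now rewrite Rinv_inv.
- intro E.
  assert (NZ : forall t, G t <> 0).
  { intro t; destruct (E t) as [H1 ->]; now apply Rinv_neq_0_compat. }
  split; [|split; [|now exists 0]].
  + apply riccati_iff_lyapunov_inv; trivial.
    intro t.
    apply is_derive_ext with (periodic_H A M T).
    { intro s; now rewrite (proj2 (E s)), Rinv_inv. }
    rewrite (proj2 (E t)), Rinv_inv.
    now apply periodic_H_lyapunov.
  + intro t; now rewrite !(fun s => proj2 (E s)), periodic_H_periodic.
Qed.

(** * Positivity of the periodic solution *)

Lemma RInt_nonneg_pos (f : R -> R) (a c s : R) :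
  (forall t, continuous f t) -> (forall t, 0 <= f t) ->
  a < c -> a <= s <= c -> 0 < f s -> 0 < RInt f a c.
Proof.
intros Hf Hpos Hac Hs Hfs.
assert (L : locally s (fun x => 0 < f x))
  by (apply (Hf s); now apply (open_gt 0)).
destruct L as [e He].
(* Clipping to [[a, c]] keeps a nondegenerate interval even if [s] is an endpoint; half the radius
   keeps it inside the ball where [f] is positive. *)
set (u := Rmax a (s - e / 2)); set (v := Rmin c (s + e / 2)).
pose proof (cond_pos e) as Pe.
assert (Hu : a <= u /\ s - e / 2 <= u /\ u <= s)
  by (unfold u, Rmax; destruct Rle_dec; lra).
assert (Hv : v <= c /\ v <= s + e / 2 /\ s <= v /\ u < v)
  by (unfold v, u, Rmin, Rmax; do 2 destruct Rle_dec; lra).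
rewrite <- (RInt_Chasles_all f a u c), <- (RInt_Chasles_all f u v c) by assumption.
assert (0 <= RInt f a u)
  by (apply RInt_ge_0; [lra | now apply ex_RInt_continuous_all | auto]).
assert (0 <= RInt f v c)
  by (apply RInt_ge_0; [lra | now apply ex_RInt_continuous_all | auto]).
assert (0 < RInt f u v).
{ apply RInt_gt_0; [lra | | auto].
  intros x Hx; apply He; unfold ball; simpl; unfold AbsRing_ball, abs, minus, plus, opp; simpl.
  apply Rabs_def1; lra. }
lra.
Qed.

Lemma continuous_lyapunov_integrand (A M : R -> R) (T : R) :
  (forall s, continuous A s) -> (forall s, continuous M s) ->
  forall s, continuous (fun s => A s * exp (2 * RInt M s T)) s.
Proof.
intros HA HM s; apply continuous_Rmult; [apply HA|].
apply continuous_exp_comp, continuous_Rmult; [apply continuous_const|].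
(* The variable is the lower limit of integration; it is moved to an upper limit. *)
apply continuous_ext with (fun s => RInt M 0 T + - RInt M 0 s).
{ intro x; change (RInt M 0 T + - RInt M 0 x = RInt M x T).
  rewrite <- (RInt_Chasles_all M 0 x T HM); ring. }
apply continuous_Rplus; [apply continuous_const|].
apply continuous_Ropp, (continuous_of_derive _ M).
intro; now apply is_derive_primitive.
Qed.

(** The numerator of [periodic_H0] is never negative and is positive exactly when [A] is not
    identically zero; the sign of the denominator is decided by that of the integral of [M]. *)
Lemma periodic_H0_pos_iff (A M : R -> R) (T : R) :
  (forall s, continuous A s) -> (forall s, continuous M s) ->
  periodic T A -> 0 < T -> (forall t, 0 <= A t) ->
  (exp (RInt M 0 T) < 1 /\ ~ (forall t, A t = 0) <->
   exp (2 * RInt M 0 T) <> 1 /\ 0 < periodic_H0 A M T).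
Proof.
intros HA HM PA HT Apos.
rewrite exp_lt_1.
set (F := fun s => A s * exp (2 * RInt M s T)).
assert (HF : forall s, continuous F s) by now apply continuous_lyapunov_integrand.
assert (Fpos : forall s, 0 <= F s)
  by (intro s; apply Rmult_le_pos; [apply Apos | left; apply exp_pos]).
assert (Npos : 0 <= RInt F 0 T)
  by (apply RInt_ge_0; [lra | now apply ex_RInt_continuous_all | auto]).
unfold periodic_H0; fold F; split.
- intros [Hneg HA0].
  assert (q : exp (2 * RInt M 0 T) < 1) by (apply exp_lt_1; lra).
  split; [lra|].
  apply Rmult_lt_0_compat; [|apply Rinv_0_lt_compat; lra].
  destruct Npos as [|N0]; [assumption|].
  (* If the numerator were zero, [A] would vanish on one period, since a positive value there makes
     the integral positive; periodicity extends this to every [t]. *)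
  exfalso; apply HA0; intro t.
  destruct (periodic_reduce R T A HT PA t) as [s [Hs <-]].
  destruct (Apos s) as [As|]; [|now symmetry].
  enough (0 < RInt F 0 T) by lra.
  apply RInt_nonneg_pos with s; trivial.
  apply Rmult_lt_0_compat; [assumption | apply exp_pos].
- intros [q1 Hq].
  destruct (Rtotal_order (exp (2 * RInt M 0 T)) 1) as [q|[q|q]]; [|contradiction|].
  + apply exp_lt_1 in q; split; [lra|].
    intro A0; rewrite (RInt_ext F (fun _ => 0)) in Hq.
    * rewrite RInt_const in Hq; change scal with Rmult in Hq; simpl in Hq.
      unfold Rdiv in Hq; rewrite Rmult_0_r, Rmult_0_l in Hq; lra.
    * intros s _; unfold F; rewrite A0; apply Rmult_0_l.
  (* Here the denominator is negative and the numerator nonnegative, so the quotient cannot be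
     positive. *)
  + exfalso.
    assert (/ (1 - exp (2 * RInt M 0 T)) < 0) by (apply Rinv_lt_0_compat; lra).
    unfold Rdiv in Hq.
    nra.
Qed.

(* For [t >= 0] positivity is read off the solution formula; periodicity
   carries it to negative times. *)
Lemma periodic_H_pos (A M : R -> R) (T : R) :
  (forall s, continuous A s) -> (forall s, continuous M s) ->
  periodic T A -> periodic T M -> 0 < T -> (forall t, 0 <= A t) ->
  exp (2 * RInt M 0 T) <> 1 -> 0 < periodic_H0 A M T ->
  forall t, 0 < periodic_H A M T t.
Proof.
intros HA HM PA PM HT Apos q1 H0 t.
destruct (periodic_nonneg_shift R T (periodic_H A M T) HT
  (periodic_H_periodic A M T HA HM PA PM q1) t) as [s [Hs <-]].
apply Rplus_lt_le_0_compat.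
- apply Rmult_lt_0_compat; [assumption | apply exp_pos].
- apply RInt_ge_0; [assumption | |].
  + now apply ex_RInt_continuous_all, continuous_lyapunov_integrand.
  + intros x _; apply Rmult_le_pos; [apply Apos | left; apply exp_pos].
Qed.

Lemma unique_positive_periodic_riccati (A M : R -> R) (T : R) :
  (forall s, continuous A s) -> (forall s, continuous M s) ->
  periodic T A -> periodic T M -> 0 < T -> (forall t, 0 <= A t) ->
  exp (2 * RInt M 0 T) <> 1 -> 0 < periodic_H0 A M T ->
  exists G : R -> R,
    (riccati A M G /\ periodic T G /\ (forall t, 0 < G t)) /\
    (forall G' : R -> R,
       riccati A M G' /\ periodic T G' /\ (forall t, 0 < G' t) ->
       forall t, G' t = G t).
Proof.
intros HA HM PA PM HT Apos q1 H0.
assert (Hpos := periodic_H_pos A M T HA HM PA PM HT Apos q1 H0).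
exists (fun t => / periodic_H A M T t); split.
- assert (E : forall t, periodic_H A M T t <> 0 /\
      / periodic_H A M T t = / periodic_H A M T t).
  { intro t; split; [|reflexivity]; apply Rgt_not_eq, Hpos. }
  apply (periodic_riccati_iff A M T HA HM PA PM q1
    (fun t => / periodic_H A M T t)) in E.
  destruct E as [HR [HP _]].
  split; [|split]; trivial; intro t; apply Rinv_0_lt_compat, Hpos.
- intros G' [R [P Pos]].
  (* A positive solution is in particular nonzero at time 0, so the characterization identifies it
     with [/ periodic_H]. *)
  apply (periodic_riccati_iff A M T HA HM PA PM q1 G').
  split; [|split]; trivial; exists 0; apply Rgt_not_eq, Pos.
Qed.

(** * The variational equation along the cycle *)

Lemma is_derive_fst (f : R -> R * R) (t : R) (l : R * R) :
  is_derive f t l -> is_derive (fun s => fst (f s)) t (fst l).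
Proof.
intro D.
apply (filterdiff_comp' (V := prod_NormedModule R_AbsRing R_NormedModule R_NormedModule)
  (W := R_NormedModule) f fst t _ fst D).
apply filterdiff_linear, is_linear_fst.
Qed.

Lemma is_derive_snd (f : R -> R * R) (t : R) (l : R * R) :
  is_derive f t l -> is_derive (fun s => snd (f s)) t (snd l).
Proof.
intro D.
apply (filterdiff_comp' (V := prod_NormedModule R_AbsRing R_NormedModule R_NormedModule)
  (W := R_NormedModule) f snd t _ snd D).
apply filterdiff_linear, is_linear_snd.
Qed.

Lemma continuous_2d_comp (f : R -> R -> R) (g h : R -> R) (t : R) :
  continuity_2d_pt f (g t) (h t) -> continuous g t -> continuous h t ->
  continuous (fun s => f (g s) (h s)) t.
Proof.
intros Hf Hg Hh; apply continuous_comp_2; trivial.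
now apply continuity_2d_pt_filterlim in Hf.
Qed.

Lemma is_derive_2d_comp (f : R -> R -> R) (g h : R -> R) (t dg dh : R) :
  (forall x y, ex_diff_n f 1 x y) -> is_derive g t dg -> is_derive h t dh ->
  is_derive (fun s => f (g s) (h s)) t
    (Derive (fun u => f u (h t)) (g t) * dg
     + Derive (fun v => f (g t) v) (h t) * dh).
Proof.
intros Hf Hg Hh.
apply is_derive_Reals.
apply derivable_pt_lim_comp_2d; [|now apply is_derive_Reals..].
apply filterdiff_differentiable_pt_lim.
(* Total differentiability comes from the first partial derivative, existing nearby and continuous
   at the point, together with the second one at the point. *)
apply is_derive_filterdiff with (dfx := fun x y => Derive (fun u => f u y) x).
- apply filter_forall; intros [x y]; simpl.
  apply Derive_correct, (Hf x y).
- apply Derive_correct, (Hf (g t) (h t)).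
- destruct (Hf (g t) (h t)) as [_ [_ [_ [[C _] _]]]].
  now apply continuity_2d_pt_filterlim in C.
Qed.

Lemma inner_self_pos (u : R * R) : u <> (0, 0) -> 0 < inner u u.
Proof.
destruct u as [x y]; unfold inner; simpl; intro Hu.
destruct (Req_dec x 0) as [->|]; [destruct (Req_dec y 0) as [->|]|].
- now contradiction Hu.
- nra.
- nra.
Qed.

Lemma velocity_field (b : R * R -> R * R) (gamma : R -> R * R) (T : R) :
  limit_cycle b gamma T -> forall t, velocity gamma t = b (gamma t).
Proof.
intros [D _] t; rewrite (surjective_pairing (b (gamma t))).
unfold velocity; f_equal; apply is_derive_unique.
- apply is_derive_fst, D.
- apply is_derive_snd, D.
Qed.

Lemma jacobian_continuous (b : R * R -> R * R) (gamma : R -> R * R) (T : R) :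
  smooth_field b -> limit_cycle b gamma T ->
  forall i j t, (i < 2)%nat -> (j < 2)%nat ->
  continuous (fun s => coeff_mat 0 (jacobian b (gamma s)) i j) t.
Proof.
intros Hb [D _] i j t Hi Hj.
assert (C1 : continuous (fun s => fst (gamma s)) t)
  by (eapply continuous_of_derive; intro s; apply is_derive_fst, D).
assert (C2 : continuous (fun s => snd (gamma s)) t)
  by (eapply continuous_of_derive; intro s; apply is_derive_snd, D).
(* Smoothness of order 1 supplies continuity of the four first partial derivatives at [gamma t]. *)
destruct (Hb 1%nat (fst (gamma t)) (snd (gamma t)))
  as [[_ [_ [_ [[F1 _] [F2 _]]]]] [_ [_ [_ [[G1 _] [G2 _]]]]]].
destruct i as [|[|i]]; [| |lia];
  (destruct j as [|[|j]]; [| |lia]).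
- exact (continuous_2d_comp _ _ _ t F1 C1 C2).
- exact (continuous_2d_comp _ _ _ t F2 C1 C2).
- exact (continuous_2d_comp _ _ _ t G1 C1 C2).
- exact (continuous_2d_comp _ _ _ t G2 C1 C2).
Qed.

Definition variational_solution (B : R -> @matrix R 2 2) (y : R -> R * R) : Prop :=
  forall t,
    is_derive (fun s => fst (y s)) t (fst (apply_mat (B t) (y t))) /\
    is_derive (fun s => snd (y s)) t (snd (apply_mat (B t) (y t))).

Lemma velocity_variational (b : R * R -> R * R) (gamma : R -> R * R) (T : R) :
  smooth_field b -> limit_cycle b gamma T ->
  variational_solution (fun t => jacobian b (gamma t)) (velocity gamma).
Proof.
intros Hb Hc t.
pose proof (velocity_field b gamma T Hc) as V.
destruct Hc as [D _].
rewrite V; split.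
- apply is_derive_ext with (fun s => fst (b (fst (gamma s), snd (gamma s)))).
  { intro s; now rewrite V, <- surjective_pairing. }
  apply (is_derive_2d_comp (fun x y => fst (b (x, y)))).
  + intros x y; apply Hb.
  + apply is_derive_fst, D.
  + apply is_derive_snd, D.
- apply is_derive_ext with (fun s => snd (b (fst (gamma s), snd (gamma s)))).
  { intro s; now rewrite V, <- surjective_pairing. }
  apply (is_derive_2d_comp (fun x y => snd (b (x, y)))).
  + intros x y; apply Hb.
  + apply is_derive_fst, D.
  + apply is_derive_snd, D.
Qed.

(* [v] spans the tangent line and [w = rot90 v] the normal line; using [w]
   instead of the unit normal avoids square roots. *)
Lemma quadratic_form_normal (gamma : R -> R * R) (B : @matrix R 2 2) (t : R) :
  velocity gamma t <> (0, 0) ->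
  let v := velocity gamma t in
  inner (unit_normal gamma t) (apply_mat B (unit_normal gamma t)) =
  inner (rot90 v) (apply_mat B (rot90 v)) / inner v v.
Proof.
intros Hv v.
pose proof (inner_self_pos _ Hv) as P.
unfold unit_normal, unit_tangent; fold v; fold v in P.
assert (N0 : norm2 v <> 0) by (apply Rgt_not_eq, sqrt_lt_R0, P).
assert (N : norm2 v * norm2 v = inner v v) by (apply sqrt_sqrt; lra).
rewrite <- N; clearbody v; unfold inner, apply_mat, rot90; simpl.
field; assumption.
Qed.

Lemma coeff_mat_Mmult_2 (P Q : @matrix R 2 2) (i j : nat) :
  (i < 2)%nat -> (j < 2)%nat ->
  coeff_mat 0 (@Mmult R_Ring 2 2 2 P Q) i j =
  coeff_mat 0 P i 0 * coeff_mat 0 Q 0 j + coeff_mat 0 P i 1 * coeff_mat 0 Q 1 j.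
Proof.
intros Hi Hj; unfold Mmult; change 0 with (@zero R_Ring).
rewrite coeff_mat_bij by assumption.
change (Init.Nat.pred 2) with 1%nat; now rewrite sum_Sn, sum_O.
Qed.

Lemma diffusion_form_nonneg (S : R * R -> @matrix R 2 2) (x n : R * R) :
  0 <= inner n (apply_mat (diffusion S x) n).
Proof.
unfold inner, apply_mat, diffusion; rewrite !coeff_mat_Mmult_2 by lia.
unfold transpose; rewrite !coeff_mat_bij by lia.
set (a := coeff_mat _ _ 0 0); set (c := coeff_mat _ _ 0 1);
set (d := coeff_mat _ _ 1 0); set (e := coeff_mat _ _ 1 1).
(* The form is the squared length of the transpose of [S x] applied to [n]; the two squares are its
   components. *)
simpl; match goal with |- 0 <= ?X => replace X with
  ((a * fst n + d * snd n)^2 + (c * fst n + e * snd n)^2) by ring end.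
apply Rplus_le_le_0_compat; apply pow2_ge_0.
Qed.

(** * Multipliers, Liouville's formula and fundamental matrices *)

Definition det2 (P : @matrix R 2 2) : R :=
  coeff_mat 0 P 0 0 * coeff_mat 0 P 1 1 - coeff_mat 0 P 0 1 * coeff_mat 0 P 1 0.

Definition trace2 (P : @matrix R 2 2) : R :=
  coeff_mat 0 P 0 0 + coeff_mat 0 P 1 1.

Lemma eigenvalues_trace_det (P : @matrix R 2 2) (mu1 mu2 : R) :
  trace2 P = mu1 + mu2 -> det2 P = mu1 * mu2 -> eigenvalues P mu1 mu2.
Proof.
unfold trace2, det2; intros Ht Hd z.
set (p := coeff_mat 0 P 0 0) in *; set (q := coeff_mat 0 P 0 1) in *.
set (r := coeff_mat 0 P 1 0) in *; set (s := coeff_mat 0 P 1 1) in *.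
apply (f_equal RtoC) in Ht; apply (f_equal RtoC) in Hd.
rewrite !RtoC_plus in Ht; rewrite RtoC_minus, !RtoC_mult in Hd.
transitivity (z * z - (RtoC p + RtoC s) * z
              + (RtoC p * RtoC s - RtoC q * RtoC r))%C; [ring|].
rewrite Ht, Hd; ring.
Qed.

(** At z = 0 the characteristic polynomial equals the determinant, and its factored form equals 1 *
    mu. *)
Lemma eigenvalues_det (P : @matrix R 2 2) (mu : C) :
  eigenvalues P (RtoC 1) mu -> mu = RtoC (det2 P).
Proof.
intro E; specialize (E (RtoC 0)).
unfold det2; rewrite RtoC_minus, !RtoC_mult.
transitivity ((RtoC 0 - RtoC 1) * (RtoC 0 - mu))%C; [ring|].
rewrite <- E; ring.
Qed.

(** The product rule on the four entries gives the determinant the scalar equation d' = tr(B) d with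
    initial value 1. *)
Lemma liouville_formula (b : R * R -> R * R) (gamma : R -> R * R)
  (Phi : R -> @matrix R 2 2) :
  (forall i j t, (i < 2)%nat -> (j < 2)%nat ->
     continuous (fun s => coeff_mat 0 (jacobian b (gamma s)) i j) t) ->
  fundamental_matrix b gamma Phi ->
  forall t, det2 (Phi t) =
            exp (RInt (fun s => trace2 (jacobian b (gamma s))) 0 t).
Proof.
intros HJ [H0 HD] t.
assert (E0 : det2 (Phi 0) = 1)
  by (rewrite H0; unfold det2, Mone; rewrite !coeff_mat_bij by lia; simpl;
      unfold one, zero; simpl; ring).
rewrite <- (Rmult_1_l (exp _)), <- E0.
apply (linear_ode_solution (fun s => trace2 (jacobian b (gamma s)))
  (fun s => det2 (Phi s))).
- intro x; apply continuous_Rplus; apply HJ; lia.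
- intro x.
  assert (K : forall i j, (i < 2)%nat -> (j < 2)%nat -> is_derive
    (fun s => coeff_mat 0 (Phi s) i j) x
    (coeff_mat 0 (jacobian b (gamma x)) i 0 * coeff_mat 0 (Phi x) 0 j +
     coeff_mat 0 (jacobian b (gamma x)) i 1 * coeff_mat 0 (Phi x) 1 j)).
  { intros i j Hi Hj; rewrite <- coeff_mat_Mmult_2 by assumption; now apply HD. }
  assert (D00 := K 0%nat 0%nat ltac:(lia) ltac:(lia)).
  assert (D01 := K 0%nat 1%nat ltac:(lia) ltac:(lia)).
  assert (D10 := K 1%nat 0%nat ltac:(lia) ltac:(lia)).
  assert (D11 := K 1%nat 1%nat ltac:(lia) ltac:(lia)).
  unfold det2, trace2; clear - D00 D01 D10 D11.
  evar_last.
  + apply (@is_derive_minus R_AbsRing R_NormedModule).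
    * apply (is_derive_mult _ _ _ _ _ D00 D11 Rmult_comm).
    * apply (is_derive_mult _ _ _ _ _ D01 D10 Rmult_comm).
  + unfold minus, plus, opp, mult; simpl; ring.
Qed.

(** This is W(t) W(0)^{-1}, where W has columns [v] and [y]; [d] is the Wronskian det W(0). *)
Definition fundamental_of_pair (v y : R -> R * R) (t : R) : @matrix R 2 2 :=
  let d := fst (v 0) * snd (y 0) - snd (v 0) * fst (y 0) in
  let row := fun vi yi j => match j with
    | O => (vi * snd (y 0) - yi * snd (v 0)) / d
    | _ => (yi * fst (v 0) - vi * fst (y 0)) / d
    end in
  mk_matrix 2 2 (fun i j => match i with
    | O => row (fst (v t)) (fst (y t)) j
    | _ => row (snd (v t)) (snd (y t)) j
    end).

(** Each column is a combination of [v] and [y] with constant coefficients, hence a solution by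
    linearity. *)
Lemma fundamental_of_pair_correct (b : R * R -> R * R) (gamma : R -> R * R)
  (v y : R -> R * R) :
  let B := fun t => jacobian b (gamma t) in
  variational_solution B v -> variational_solution B y ->
  fst (v 0) * snd (y 0) - snd (v 0) * fst (y 0) <> 0 ->
  fundamental_matrix b gamma (fundamental_of_pair v y).
Proof.
intros B Hv Hy Hd; split.
- unfold fundamental_of_pair, Mone.
  apply (coeff_mat_ext_aux 0 0); intros i j Hi Hj.
  rewrite !coeff_mat_bij by assumption.
  destruct i as [|[|i]]; [| |lia]; (destruct j as [|[|j]]; [| |lia]); simpl;
    unfold one, zero; simpl; field; assumption.
- intros i j t Hi Hj; rewrite coeff_mat_Mmult_2 by assumption.
  destruct (Hv t) as [V1 V2]; destruct (Hy t) as [Y1 Y2].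
  unfold apply_mat in *; simpl in V1, V2, Y1, Y2; fold (B t).
  set (d := fst (v 0) * snd (y 0) - snd (v 0) * fst (y 0)) in *.
  assert (L : forall (f g : R -> R) (df dg c1 c2 : R),
    is_derive f t df -> is_derive g t dg ->
    is_derive (fun s => (f s * c1 - g s * c2) / d) t
              ((df * c1 - dg * c2) / d)).
  { intros f g df dg c1 c2 Df Dg; auto_derive.
    - split; [eexists; eassumption | split; [eexists; eassumption | exact I]].
    - derive_values; field; assumption. }
  unfold fundamental_of_pair; rewrite !coeff_mat_bij by lia; fold d.
  destruct i as [|[|i]]; [| |lia]; (destruct j as [|[|j]]; [| |lia]).
  + apply is_derive_ext with
      (fun s => (fst (v s) * snd (y 0) - fst (y s) * snd (v 0)) / d);
      [intro s; now rewrite coeff_mat_bij by lia|].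
    evar_last; [apply L; eassumption | simpl; field; assumption].
  + apply is_derive_ext with
      (fun s => (fst (y s) * fst (v 0) - fst (v s) * fst (y 0)) / d);
      [intro s; now rewrite coeff_mat_bij by lia|].
    evar_last; [apply L; eassumption | simpl; field; assumption].
  + apply is_derive_ext with
      (fun s => (snd (v s) * snd (y 0) - snd (y s) * snd (v 0)) / d);
      [intro s; now rewrite coeff_mat_bij by lia|].
    evar_last; [apply L; eassumption | simpl; field; assumption].
  + apply is_derive_ext with
      (fun s => (snd (y s) * fst (v 0) - snd (v s) * fst (y 0)) / d);
      [intro s; now rewrite coeff_mat_bij by lia|].
    evar_last; [apply L; eassumption | simpl; field; assumption].
Qed.

(** In the basis [v 0], [y 0] the monodromy matrix is upper triangular with diagonal 1, [q] and
    corner entry [c]; trace and determinant do not depend on the basis. *)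
Lemma fundamental_of_pair_multipliers (v y : R -> R * R) (T c q : R) :
  fst (v 0) * snd (y 0) - snd (v 0) * fst (y 0) <> 0 ->
  v T = v 0 ->
  fst (y T) = c * fst (v 0) + q * fst (y 0) ->
  snd (y T) = c * snd (v 0) + q * snd (y 0) ->
  trace2 (fundamental_of_pair v y T) = 1 + q /\
  det2 (fundamental_of_pair v y T) = q.
Proof.
intros Hd Ev E1 E2; unfold trace2, det2, fundamental_of_pair.
rewrite !coeff_mat_bij by lia; cbv beta iota zeta.
rewrite Ev, E1, E2; split; field; assumption.
Qed.

(** * Reduction of order in the moving frame *)

Lemma continuous_normal_form (B : R -> @matrix R 2 2) (v : R -> R * R) :
  (forall i j t, (i < 2)%nat -> (j < 2)%nat ->
     continuous (fun s => coeff_mat 0 (B s) i j) t) ->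
  (forall t, continuous (fun s => fst (v s)) t) ->
  (forall t, continuous (fun s => snd (v s)) t) ->
  (forall t, 0 < inner (v t) (v t)) ->
  forall t, continuous (fun s =>
    inner (rot90 (v s)) (apply_mat (B s) (rot90 (v s))) / inner (v s) (v s)) t.
Proof.
intros HB C1 C2 Hpos t.
set (v1 := fun t => fst (v t)); set (v2 := fun t => snd (v t)).
change (forall t, continuous v1 t) in C1; change (forall t, continuous v2 t) in C2.
set (p := fun t => coeff_mat 0 (B t) 0 0).
set (q := fun t => coeff_mat 0 (B t) 0 1).
set (r := fun t => coeff_mat 0 (B t) 1 0).
set (s := fun t => coeff_mat 0 (B t) 1 1).
assert (Cp : forall t, continuous p t) by (intro; apply HB; lia).
assert (Cq : forall t, continuous q t) by (intro; apply HB; lia).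
assert (Cr : forall t, continuous r t) by (intro; apply HB; lia).
assert (Cs : forall t, continuous s t) by (intro; apply HB; lia).
apply continuous_Rmult.
- apply continuous_ext with (fun t =>
    - v2 t * (p t * - v2 t + q t * v1 t) + v1 t * (r t * - v2 t + s t * v1 t));
    [reflexivity|].
  continuity_R.
- apply continuous_Rinv_comp; [|apply Rgt_not_eq, Hpos].
  apply continuous_ext with (fun t => v1 t * v1 t + v2 t * v2 t);
    [reflexivity|].
  continuity_R.
Qed.

(* Reduction of order in the moving frame [v], [w = rot90 v]: the ansatz
   [y = alpha v + delta w] decouples into
   [delta' = (M - <v, B v> / |v|^2) delta], solved by
   [delta = exp (int M) / |v|], and a quadrature for [alpha]. *)
Lemma transverse_solution (B : R -> @matrix R 2 2) (v : R -> R * R) (M : R -> R) :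
  (forall i j t, (i < 2)%nat -> (j < 2)%nat ->
     continuous (fun s => coeff_mat 0 (B s) i j) t) ->
  variational_solution B v -> (forall t, 0 < inner (v t) (v t)) ->
  (forall t, M t =
    inner (rot90 (v t)) (apply_mat (B t) (rot90 (v t))) / inner (v t) (v t)) ->
  let delta := fun t => exp (RInt M 0 t) / norm2 (v t) in
  exists alpha : R -> R, alpha 0 = 0 /\
    variational_solution B
      (fun t => (alpha t * fst (v t) + delta t * fst (rot90 (v t)),
                 alpha t * snd (v t) + delta t * snd (rot90 (v t)))).
Proof.
intros HB Hv Hpos EM delta.
set (v1 := fun t => fst (v t)); set (v2 := fun t => snd (v t)).
set (N := fun t => v1 t * v1 t + v2 t * v2 t).
set (p := fun t => coeff_mat 0 (B t) 0 0).
set (q := fun t => coeff_mat 0 (B t) 0 1).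
set (r := fun t => coeff_mat 0 (B t) 1 0).
set (s := fun t => coeff_mat 0 (B t) 1 1).
assert (Cp : forall t, continuous p t) by (intro; apply HB; lia).
assert (Cq : forall t, continuous q t) by (intro; apply HB; lia).
assert (Cr : forall t, continuous r t) by (intro; apply HB; lia).
assert (Cs : forall t, continuous s t) by (intro; apply HB; lia).
assert (D1 : forall t, is_derive v1 t (p t * v1 t + q t * v2 t)) by apply Hv.
assert (D2 : forall t, is_derive v2 t (r t * v1 t + s t * v2 t)) by apply Hv.
assert (C1 := continuous_of_derive _ _ D1).
assert (C2 := continuous_of_derive _ _ D2).
assert (NP : forall t, 0 < N t) by apply Hpos.
assert (CI : forall t, continuous (fun t => / N t) t).
{ intro t; apply continuous_Rinv_comp; [|apply Rgt_not_eq, NP].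
  unfold N; continuity_R. }
assert (CM : forall t, continuous M t).
{ intro t; eapply continuous_ext; [intro x; symmetry; apply EM|].
  now apply continuous_normal_form. }
set (m := fun t => RInt M 0 t).
assert (Dm : forall t, is_derive m t (M t))
  by (intro; now apply is_derive_primitive).
(* The correction to [M] is the logarithmic derivative of |v|, because (|v|^2)' = 2 <v, B v>. *)
assert (Ddelta : forall t, is_derive delta t
  ((M t - (v1 t * (p t * v1 t + q t * v2 t) + v2 t * (r t * v1 t + s t * v2 t))
     / N t) * delta t)).
{ intro t; specialize (D1 t); specialize (D2 t); specialize (Dm t).
  specialize (NP t).
  assert (S0 : 0 < sqrt (N t)) by now apply sqrt_lt_R0.
  assert (S2 : sqrt (N t) * sqrt (N t) = N t) by (apply sqrt_sqrt; lra).
  apply is_derive_ext with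
    (fun t => exp (m t) / sqrt (v1 t * v1 t + v2 t * v2 t)); [reflexivity|].
  auto_derive.
  - repeat split; try (eexists; eassumption); try assumption.
    apply Rgt_not_eq, S0.
  - derive_values.
    change (delta t) with (exp (m t) / sqrt (N t)).
    (* The root becomes a variable [n] with [N t] replaced by [n * n], so that the identity is
       rational. *)
    fold (N t); revert S0 S2; generalize (sqrt (N t)); intros n S0 <-.
    field; lra. }
(* Pairing the equation for [y] with [v] gives alpha' = delta (<v, B w> + <w, B v>) / |v|^2; the
   second term comes from w' = rot90 (B v). *)
set (kappa := fun t => delta t *
  (v1 t * (- p t * v2 t + q t * v1 t + r t * v1 t + s t * v2 t)
   + v2 t * (- r t * v2 t + s t * v1 t - p t * v1 t - q t * v2 t)) / N t).
assert (Cd := continuous_of_derive _ _ Ddelta).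
assert (Ck : forall t, continuous kappa t).
{ intro t; unfold kappa, Rminus; apply continuous_Rmult; [|apply CI].
  continuity_R. }
set (alpha := fun t => RInt kappa 0 t).
assert (Da : forall t, is_derive alpha t (kappa t))
  by (intro; now apply is_derive_primitive).
exists alpha; split; [apply RInt_zero_width|].
intro t; specialize (D1 t); specialize (D2 t); specialize (Da t).
specialize (Ddelta t); specialize (NP t).
assert (EMt : M t = (- v2 t * (p t * - v2 t + q t * v1 t)
                     + v1 t * (r t * - v2 t + s t * v1 t)) / N t)
  by (rewrite EM; reflexivity).
rewrite EMt in Ddelta.
unfold apply_mat; simpl; fold (p t) (q t) (r t) (s t) (v1 t) (v2 t); split.
- apply is_derive_ext with (fun t => alpha t * v1 t + delta t * - v2 t);
    [reflexivity|].
  auto_derive.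
  + repeat split; eexists; eassumption.
  + derive_values; unfold kappa, N; field; fold (N t); lra.
- apply is_derive_ext with (fun t => alpha t * v2 t + delta t * v1 t);
    [reflexivity|].
  auto_derive.
  + repeat split; eexists; eassumption.
  + derive_values; unfold kappa, N; field; fold (N t); lra.
Qed.

(** * Regularity and periodicity of the coefficients *)

Lemma diffusion_continuous (sigma : R * R -> @matrix R 2 2) (gamma : R -> R * R) :
  continuous_matrix_field sigma -> (forall t, continuous gamma t) ->
  forall i j t, (i < 2)%nat -> (j < 2)%nat ->
  continuous (fun s => coeff_mat 0 (diffusion sigma (gamma s)) i j) t.
Proof.
intros Hs Hg i j t Hi Hj.
assert (K : forall i j, (i < 2)%nat -> (j < 2)%nat ->
  continuous (fun s => coeff_mat 0 (sigma (gamma s)) i j) t)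
  by (intros k l Hk Hl;
      apply (continuous_comp gamma (fun y => coeff_mat 0 (sigma y) k l));
      [apply Hg | now apply Hs]).
apply continuous_ext with (fun s =>
  coeff_mat 0 (sigma (gamma s)) i 0 * coeff_mat 0 (sigma (gamma s)) j 0 +
  coeff_mat 0 (sigma (gamma s)) i 1 * coeff_mat 0 (sigma (gamma s)) j 1).
{ intro s; unfold diffusion; rewrite coeff_mat_Mmult_2 by assumption.
  unfold transpose; now rewrite !coeff_mat_bij by lia. }
apply continuous_Rplus; apply continuous_Rmult; apply K; lia.
Qed.

Lemma limit_cycle_velocity_pos (b : R * R -> R * R) (gamma : R -> R * R) (T : R) :
  limit_cycle b gamma T ->
  forall t, 0 < inner (velocity gamma t) (velocity gamma t).
Proof. intros [_ [_ [_ [_ NZ]]]] t; apply inner_self_pos, NZ. Qed.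

Lemma velocity_periodic (b : R * R -> R * R) (gamma : R -> R * R) (T : R) :
  limit_cycle b gamma T -> periodic T (velocity gamma).
Proof.
intros Hc t; rewrite !(velocity_field b gamma T Hc).
destruct Hc as [_ [_ [P _]]]; now rewrite P.
Qed.

(** A general matrix field [B] covers both [A_tilde], from the diffusion matrix, and [M_tilde], from
    the Jacobian. *)
Lemma continuous_normal_normal (b : R * R -> R * R) (gamma : R -> R * R) (T : R)
  (B : R * R -> @matrix R 2 2) :
  smooth_field b -> limit_cycle b gamma T ->
  (forall i j t, (i < 2)%nat -> (j < 2)%nat ->
     continuous (fun s => coeff_mat 0 (B (gamma s)) i j) t) ->
  forall t, continuous (fun s =>
    inner (unit_normal gamma s) (apply_mat (B (gamma s)) (unit_normal gamma s))) t.
Proof.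
intros Hb Hc HB t.
assert (V := velocity_variational b gamma T Hb Hc).
eapply continuous_ext;
  [intro s; symmetry; apply quadratic_form_normal; apply Hc|].
apply (continuous_normal_form (fun s => B (gamma s))); trivial.
- exact (continuous_of_derive _ _ (fun s => proj1 (V s))).
- exact (continuous_of_derive _ _ (fun s => proj2 (V s))).
- now apply limit_cycle_velocity_pos with b T.
Qed.

Lemma periodic_normal_normal (b : R * R -> R * R) (gamma : R -> R * R) (T : R)
  (B : R * R -> @matrix R 2 2) :
  limit_cycle b gamma T ->
  periodic T (fun s =>
    inner (unit_normal gamma s) (apply_mat (B (gamma s)) (unit_normal gamma s))).
Proof.
intros Hc t; unfold unit_normal, unit_tangent.
rewrite (velocity_periodic b gamma T Hc).
destruct Hc as [_ [_ [P _]]]; now rewrite P.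
Qed.

(** * The nontrivial multiplier and stability *)

Lemma transverse_multiplier (b : R * R -> R * R) (gamma : R -> R * R) (T : R) :
  smooth_field b -> limit_cycle b gamma T ->
  exists Phi : R -> @matrix R 2 2,
    fundamental_matrix b gamma Phi /\
    trace2 (Phi T) = 1 + exp (RInt (M_tilde b gamma) 0 T) /\
    det2 (Phi T) = exp (RInt (M_tilde b gamma) 0 T).
Proof.
intros Hb Hc.
set (v := velocity gamma).
assert (V := velocity_variational b gamma T Hb Hc).
assert (HB := jacobian_continuous b gamma T Hb Hc).
assert (Hpos := limit_cycle_velocity_pos b gamma T Hc).
assert (PV := velocity_periodic b gamma T Hc 0); rewrite Rplus_0_l in PV.
assert (EM : forall t, M_tilde b gamma t =
  inner (rot90 (v t)) (apply_mat (jacobian b (gamma t)) (rot90 (v t)))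
  / inner (v t) (v t)) by (intro t; apply quadratic_form_normal, Hc).
fold v in V, Hpos, PV; clearbody v.
destruct (transverse_solution _ v (M_tilde b gamma) HB V Hpos EM)
  as [alpha [a0 Y]].
set (m := fun t => RInt (M_tilde b gamma) 0 t).
change (RInt (M_tilde b gamma) 0 T) with (m T).
match type of Y with variational_solution _ ?f => set (y := f) in Y end.
assert (n0 : 0 < norm2 (v 0)) by (apply sqrt_lt_R0, Hpos).
assert (m0 : m 0 = 0) by apply RInt_zero_width.
(* Since [alpha 0 = 0], [y 0] is the unit normal direction and the Wronskian is the length of
   [v 0]. *)
assert (Hd : fst (v 0) * snd (y 0) - snd (v 0) * fst (y 0) <> 0).
{ unfold y; simpl; fold (m 0); rewrite a0, m0, exp_0.
  replace (_ - _) with (inner (v 0) (v 0) / norm2 (v 0))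
    by (unfold inner; field; lra).
  apply Rgt_not_eq, Rdiv_lt_0_compat; [apply Hpos | assumption]. }
exists (fundamental_of_pair v y); split.
- now apply fundamental_of_pair_correct.
(* As [v T = v 0], the frame closes up, and [y T] is [alpha T] times [v 0] plus [exp (m T)] times
   [y 0]. *)
- apply fundamental_of_pair_multipliers with (alpha T); trivial;
    unfold y; simpl; fold (m T) (m 0);
    rewrite PV, a0, m0, exp_0; field; lra.
Qed.

Lemma stable_iff_multiplier (b : R * R -> R * R) (gamma : R -> R * R) (T : R) :
  smooth_field b -> limit_cycle b gamma T ->
  (exp (RInt (M_tilde b gamma) 0 T) < 1 <-> asymptotically_stable b gamma T).
Proof.
intros Hb Hc.
destruct (transverse_multiplier b gamma T Hb Hc) as [Phi [HPhi [Ht Hd]]].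
assert (HB := jacobian_continuous b gamma T Hb Hc).
set (q := exp _) in *.
assert (Cq : Cmod (RtoC q) = q)
  by (rewrite Cmod_R; apply Rabs_pos_eq; left; apply exp_pos).
split.
- intro Hq; exists Phi, (RtoC q); rewrite Cq; split; [|split]; trivial.
  apply eigenvalues_trace_det; trivial; now rewrite Rmult_1_l.
(* [Psi] is arbitrary; [mu] is its determinant at [T], which Liouville's formula equates with that
   of the explicit [Phi]. *)
- intros [Psi [mu [HPsi [E Hmu]]]].
  rewrite (eigenvalues_det _ _ E), (liouville_formula b gamma Psi HB HPsi),
    <- (liouville_formula b gamma Phi HB HPhi), Hd, Cq in Hmu.
  exact Hmu.
Qed.

(** * Assembly of the scalar and geometric results *)

Theorem mainTheorem2
  (b : R * R -> R * R) (sigma : R * R -> @matrix R 2 2)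
  (gamma : R -> R * R) (T : R)
  (b_smooth : smooth_field b)
  (sigma_cont : continuous_matrix_field sigma)
  (Gamma_cycle : limit_cycle b gamma T) :
  let A := A_tilde sigma gamma in
  let M := M_tilde b gamma in
  (forall tau : R, 0 <= A tau) /\
  (forall G : R -> R, (forall tau : R, G tau <> 0) ->
     (riccati A M G <-> lyapunov A M (fun tau => / G tau))) /\
  (forall H : R -> R,
     lyapunov A M H <->
     (forall tau : R, H tau = lyapunov_solution A M (H 0) tau)) /\
  (forall H : R -> R, lyapunov A M H ->
     (periodic T H <-> H 0 = H T) /\
     (exp (2 * RInt M 0 T) <> 1 ->
      (H 0 = H T <-> H 0 = periodic_H0 A M T))) /\
  (exp (2 * RInt M 0 T) <> 1 ->
   forall G : R -> R,
     (riccati A M G /\ periodic T G /\ (exists tau : R, G tau <> 0)) <->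
     (forall tau : R,
        periodic_H A M T tau <> 0 /\ G tau = / periodic_H A M T tau)) /\
  (exp (RInt M 0 T) < 1 <-> RInt M 0 T < 0) /\
  (exp (RInt M 0 T) < 1 <-> asymptotically_stable b gamma T) /\
  (exp (RInt M 0 T) < 1 /\ ~ (forall tau : R, A tau = 0) <->
   exp (2 * RInt M 0 T) <> 1 /\ 0 < periodic_H0 A M T) /\
  (exp (RInt M 0 T) < 1 /\ ~ (forall tau : R, A tau = 0) ->
   exists G : R -> R,
     (riccati A M G /\ periodic T G /\ (forall tau : R, 0 < G tau)) /\
     (forall G' : R -> R,
        riccati A M G' /\ periodic T G' /\ (forall tau : R, 0 < G' tau) ->
        forall tau : R, G' tau = G tau)).
Proof.
intros A M.
assert (HT : 0 < T) by apply Gamma_cycle.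
assert (Cg : forall t, continuous gamma t).
{ intro t; apply (@ex_derive_continuous R_AbsRing
    (prod_NormedModule R_AbsRing R_NormedModule R_NormedModule)).
  eexists; apply Gamma_cycle. }
assert (HA : forall t, continuous A t)
  by (apply (continuous_normal_normal b gamma T (diffusion sigma)); trivial;
      now apply diffusion_continuous).
assert (HM : forall t, continuous M t)
  by (apply (continuous_normal_normal b gamma T (jacobian b)); trivial;
      now apply jacobian_continuous with T).
assert (PA : periodic T A)
  by now apply (periodic_normal_normal b gamma T (diffusion sigma)).
assert (PM : periodic T M)
  by now apply (periodic_normal_normal b gamma T (jacobian b)).
assert (Apos : forall t, 0 <= A t) by (intro; apply diffusion_form_nonneg).
split; [exact Apos|].
split; [intros G NZ; now apply riccati_iff_lyapunov_inv|].
split; [intro H; now apply lyapunov_iff_solution|].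
split.
{ intros H HH; split; [now apply (lyapunov_periodic_iff A M)|].
  intro q1.
  (* Replacing [H T] by the solution formula turns the closing condition into an equation for [H 0]
     alone. *)
  rewrite (proj1 (lyapunov_iff_solution A M H HA HM) HH T).
  now apply lyapunov_solution_closed_iff. }
split; [now apply periodic_riccati_iff|].
split; [apply exp_lt_1|].
split; [now apply stable_iff_multiplier|].
assert (Hiff := periodic_H0_pos_iff A M T HA HM PA HT Apos).
split; [exact Hiff|].
intro Hc; apply Hiff in Hc as [q1 H0].
now apply (unique_positive_periodic_riccati A M T).
Qed.
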